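(* Let $A\subset\mathbb{R}^N$ be nonempty and closed, and let $U:[0,\infty)\rightsquigarrow\mathbb{R}^M$ be measurable with nonempty closed images. Let $H:[0,\infty)\times\mathbb{R}^N\times\mathbb{R}^N\to\mathbb{R}$ be measurable in $t$, continuous in $x$, convex in $p$, with $H(t,x,0)\le-\phi(t)$ for all $t,x$ for some $\phi\in L^1([0,\infty);\mathbb{R})$. Let $f:[0,\infty)\times\mathbb{R}^N\times\mathbb{R}^M\to\mathbb{R}^N$ and $l:[0,\infty)\times\mathbb{R}^N\times\mathbb{R}^M\to\mathbb{R}$ be Lebesgue measurable in $t$ for all $(x,u)$, continuous in $(x,u)$ for all $t$, and satisfy $l(t,x,u)\ge\phi_1(t)$ for all $t,x,u$ for some $\phi_1\in L^1([0,\infty);\mathbb{R})$. If $(U,f,l)$ is an epigraphical representation of $H$, i.e. $\mathrm{gph}H^*(t,x,\cdot)\subset(f,l)(t,x,U(t))\subset\mathrm{epi}H^*(t,x,\cdot)$ for all $t\ge0$, $x\in\mathbb{R}^N$, then the value functions $V$ and $\mathcal{V}$ are well-defined and $$V(t_0,x_0)=\mathcal{V}(t_0,x_0)\quad\text{for all }(t_0,x_0)\in[0,\infty)\times A.$$ Moreover, if $\bar x(\cdot)$ is an optimal trajectory of $V$ at $(t_0,x_0)\in\mathrm{dom}V$, then there exists a measurable $\bar u(\cdot)$ such that $(\bar x,\bar u)(\cdot)$ is an optimal pair of $\mathcal{V}$ at $(t_0,x_0)$; conversely, if $(\bar x,\bar u)(\cdot)$ is an optimal pair of $\mathcal{V}$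 at $(t_0,x_0)\in\mathrm{dom}\mathcal{V}$, then $\bar x(\cdot)$ is an optimal trajectory of $V$ at $(t_0,x_0)$.
   Context: $H^*(t,x,v)=\sup_p\{\langle v,p\rangle-H(t,x,p)\}$, $\mathrm{dom}H^*(t,x,\cdot)=\{v:H^*(t,x,v)<+\infty\}$, $\mathrm{gph}$ the graph over the domain, $\mathrm{epi}$ the epigraph, $(f,l)(t,x,u)=(f(t,x,u),l(t,x,u))$. $S_H(t_0,x_0)$: locally absolutely continuous $x:[t_0,\infty)\to\mathbb{R}^N$ with $\dot x(t)\in\mathrm{dom}H^*(t,x(t),\cdot)$ a.e., $x(t_0)=x_0$, $x([t_0,\infty))\subset A$; $V(t_0,x_0)=\inf_{x\in S_H(t_0,x_0)}\int_{t_0}^\infty H^*(t,x(t),\dot x(t))dt$. $S_f(t_0,x_0)$: pairs $(x,u)$ with $x:[t_0,\infty)\to\mathbb{R}^N$ locally absolutely continuous, $u$ measurable, $\dot x(t)=f(t,x(t),u(t))$, $u(t)\in U(t)$ a.e. $t\ge t_0$, $x(t_0)=x_0$, $x([t_0,\infty))\subset A$; $\mathcal{V}(t_0,x_0)=\inf_{(x,u)\in S_f(t_0,x_0)}\int_{t_0}^\infty l(t,x(t),u(t))dt$. Infima over empty sets are $+\infty$. An optimal trajectory (pair) is one attaining the infimum. *)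

(* Defs.v *)
From HB Require Import structures.
From mathcomp Require Import all_boot all_order all_algebra.
From mathcomp Require Import all_classical all_reals all_analysis measurable_realfun.
Set Implicit Arguments. Unset Strict Implicit. Unset Printing Implicit Defensive.
Import Order.TTheory GRing.Theory Num.Def Num.Theory numFieldNormedType.Exports.
Local Open Scope classical_set_scope.
Local Open Scope ring_scope.

(* The measurable space of reals equipped with the Lebesgue (completed) sigma-algebra. *)
Definition lebT (R : realType) := ltac:(let t := type of (@completed_lebesgue_measure R) in
  match t with set ?T -> _ => exact T end).

Notation leb R := (@completed_lebesgue_measure R).

Section defs.
Context {R : realType}.

Definition dotv {N : nat} (u v : 'rV[R]_N) : R := (u *m v^T) 0 0.

(* Lebesgue measurability of a vector-valued function on D (Borel sets of the target
   are generated by the open sets). *)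
Definition vmeasurable {n : nat} (D : set (lebT R)) (g : R -> 'rV[R]_n) : Prop :=
  forall O : set 'rV[R]_n, open O -> measurable (D `&` (g @^-1` O : set (lebT R))).

Definition setval_measurable {M : nat} (U : R -> set 'rV[R]_M) : Prop :=
  forall O : set 'rV[R]_M, open O ->
    measurable ([set t : R | 0 <= t /\ (U t `&` O) !=set0] : set (lebT R)).

Definition L1_pos (phi : R -> R) : Prop :=
  (leb R).-integrable (`[0, +oo[%classic : set (lebT R)) (EFin \o phi).

Definition convex_in_p {N : nat} (H : R -> 'rV[R]_N -> 'rV[R]_N -> R) : Prop :=
  forall t x p q (lam : R), 0 <= t -> 0 <= lam <= 1 ->
    H t x (lam *: p + (1 - lam) *: q) <= lam * H t x p + (1 - lam) * H t x q.

Definition Hstar {N : nat} (H : R -> 'rV[R]_N -> 'rV[R]_N -> R)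
    (t : R) (x v : 'rV[R]_N) : \bar R :=
  ereal_sup [set ((dotv v p - H t x p)%:E) | p in [set: 'rV[R]_N]].

Definition abs_cont_on {N : nat} (a b : R) (x : R -> 'rV[R]_N) : Prop :=
  forall e : R, 0 < e -> exists2 d : R, 0 < d &
    forall (n : nat) (c d' : nat -> R),
      (forall k, (k < n)%N -> a <= c k /\ c k <= d' k /\ d' k <= b) ->
      (forall i j, (i < n)%N -> (j < n)%N -> i <> j -> d' i <= c j \/ d' j <= c i) ->
      \sum_(k < n) (d' k - c k) < d ->
      \sum_(k < n) `|x (d' k) - x (c k)| < e.

Definition loc_abs_cont {N : nat} (t0 : R) (x : R -> 'rV[R]_N) : Prop :=
  forall T : R, t0 < T -> abs_cont_on t0 T x.

Definition S_H {N : nat} (A : set 'rV[R]_N) (H : R -> 'rV[R]_N -> 'rV[R]_N -> R)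
    (t0 : R) (x0 : 'rV[R]_N) : set (R -> 'rV[R]_N) :=
  [set x | [/\ loc_abs_cont t0 x,
     {ae leb R, forall t : lebT R, `[t0, +oo[%classic t ->
        derivable x (t : R) 1 /\ (Hstar H t (x t) ('D_1 x t) < +oo)%E},
     x t0 = x0 &
     forall t, t0 <= t -> A (x t)]].

Definition J_H {N : nat} (H : R -> 'rV[R]_N -> 'rV[R]_N -> R)
    (t0 : R) (x : R -> 'rV[R]_N) : \bar R :=
  (\int[leb R]_(t in (`[t0, +oo[%classic : set (lebT R)))
     Hstar H t (x t) ('D_1 x t))%E.

Definition V_H {N : nat} (A : set 'rV[R]_N) (H : R -> 'rV[R]_N -> 'rV[R]_N -> R)
    (t0 : R) (x0 : 'rV[R]_N) : \bar R :=
  ereal_inf [set J_H H t0 x | x in S_H A H t0 x0].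

Definition S_f {N M : nat} (A : set 'rV[R]_N) (U : R -> set 'rV[R]_M)
    (f : R -> 'rV[R]_N -> 'rV[R]_M -> 'rV[R]_N)
    (t0 : R) (x0 : 'rV[R]_N) : set ((R -> 'rV[R]_N) * (R -> 'rV[R]_M)) :=
  [set xu | [/\ loc_abs_cont t0 xu.1,
     vmeasurable (`[t0, +oo[%classic : set (lebT R)) xu.2,
     {ae leb R, forall t : lebT R, `[t0, +oo[%classic t ->
        [/\ derivable xu.1 (t : R) 1,
            'D_1 xu.1 t = f t (xu.1 t) (xu.2 t) & U t (xu.2 t)]},
     xu.1 t0 = x0 &
     forall t, t0 <= t -> A (xu.1 t)]].

Definition J_f {N M : nat} (l : R -> 'rV[R]_N -> 'rV[R]_M -> R)
    (t0 : R) (xu : (R -> 'rV[R]_N) * (R -> 'rV[R]_M)) : \bar R :=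
  (\int[leb R]_(t in (`[t0, +oo[%classic : set (lebT R)))
     (l t (xu.1 t) (xu.2 t))%:E)%E.

Definition V_f {N M : nat} (A : set 'rV[R]_N) (U : R -> set 'rV[R]_M)
    (f : R -> 'rV[R]_N -> 'rV[R]_M -> 'rV[R]_N) (l : R -> 'rV[R]_N -> 'rV[R]_M -> R)
    (t0 : R) (x0 : 'rV[R]_N) : \bar R :=
  ereal_inf [set J_f l t0 xu | xu in S_f A U f t0 x0].

Definition epi_representation {N M : nat} (H : R -> 'rV[R]_N -> 'rV[R]_N -> R)
    (U : R -> set 'rV[R]_M) (f : R -> 'rV[R]_N -> 'rV[R]_M -> 'rV[R]_N)
    (l : R -> 'rV[R]_N -> 'rV[R]_M -> R) : Prop :=
  forall (t : R) (x : 'rV[R]_N), 0 <= t ->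
    (forall v, (Hstar H t x v < +oo)%E ->
       exists2 u, U t u & f t x u = v /\ (l t x u)%:E = Hstar H t x v) /\
    (forall u, U t u -> (Hstar H t x (f t x u) <= (l t x u)%:E)%E).

Definition integral_well_defined (t0 : R) (g : R -> \bar R) : Prop :=
  measurable_fun (`[t0, +oo[%classic : set (lebT R)) (g : lebT R -> \bar R) /\
  (\int[leb R]_(t in (`[t0, +oo[%classic : set (lebT R))) (g^\- t) < +oo)%E.

End defs.

(* Main.v *)
Require Import Defs.
From HB Require Import structures.
From mathcomp Require Import all_boot all_order all_algebra.
From mathcomp Require Import all_classical all_reals all_analysis measurable_realfun.
Import Order.TTheory GRing.Theory Num.Def Num.Theory numFieldNormedType.Exports.
Local Open Scope classical_set_scope.
Local Open Scope ring_scope.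

(** Both inequalities compare the two problems trajectory by trajectory. If
    [(x, u)] is admissible for [(U, f, l)], the second inclusion of the
    representation gives [Hstar t (x t) (x' t) <= l t (x t) (u t)] almost
    everywhere, so [x] is admissible for [H] and is not more expensive.
    Conversely, along an [H]-admissible [x] the representation says that
    [Hstar t (x t) (x' t)] is the attained minimum of [l t (x t) u] over the
    controls [u] in [U t] with [f t (x t) u = x' t]. Minima of Caratheodory
    functions over measurable closed-valued multifunctions are measurable in
    [t], and iterating such minima (norm first, then each coordinate) selects
    a measurable control attaining [Hstar], hence with the same cost. *)

(** * Rational points and countable intersections *)

Lemma rat_rV_dense (R : realType) (n : nat) (u : 'rV[R]_n) (e : R) :
  0 < e -> exists q : 'rV[rat]_n, `|u - map_mx ratr q| < e.
Proof.
move=> e0.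
have /choice[q qP] : forall i : 'I_n, exists r : rat, ratr r \in `]u 0 i, u 0 i + e[.
  by move=> i; apply: rat_in_itvoo; rewrite ltrDl.
exists (\row_i q i).
suff : ball u e (map_mx ratr (\row_i q i)) by rewrite mx_norm_ball.
split => // i j; rewrite !mxE ord1 /ball /= distrC.
have /itvP qj := qP j.
by rewrite ger0_norm ?subr_ge0 ?qj// ltrBlDl qj.
Qed.

Lemma countable_bigcapT_measurable (d : measure_display) (T : measurableType d)
    (I : countType) (F : I -> set T) :
  (forall i, measurable (F i)) -> measurable (\bigcap_i F i).
Proof.
move=> mF; rewrite -[X in measurable X]setCK setC_bigcap; apply: measurableC.
by apply: countable_bigcupT_measurable => // i; exact: measurableC.
Qed.

(** * Caratheodory functions and measurable multifunctions *)

Section caratheodory_functions.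
Context {d : measure_display} {T : measurableType d} {R : realType} {n : nat}.
Implicit Types (D : set T) (U : T -> set 'rV[R]_n) (h : T -> 'rV[R]_n -> R).

Definition caratheodory D h :=
  (forall u, measurable_fun D (h^~ u)) /\ (forall t, D t -> continuous (h t)).

(** Effros measurability of the multifunction, relative to [D]. *)
Definition weakly_measurable D U :=
  forall O, open O -> measurable (D `&` [set t | U t `&` O !=set0]).

Lemma caratheodoryD D h1 h2 : caratheodory D h1 -> caratheodory D h2 ->
  caratheodory D (fun t u => h1 t u + h2 t u).
Proof.
move=> [m1 c1] [m2 c2]; split=> [u|t Dt u]; first exact: measurable_funD.
by apply: continuousD; [exact: c1|exact: c2].
Qed.

Lemma caratheodoryB D h1 h2 : caratheodory D h1 -> caratheodory D h2 ->
  caratheodory D (fun t u => h1 t u - h2 t u).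
Proof.
move=> [m1 c1] [m2 c2]; split=> [u|t Dt u]; first exact: measurable_funB.
by apply: continuousB; [exact: c1|exact: c2].
Qed.

Lemma caratheodory_norm D h : caratheodory D h ->
  caratheodory D (fun t u => `|h t u|).
Proof.
move=> [m1 c1]; split=> [u|t Dt u].
  by apply: (measurableT_comp (@normr_measurable R setT)); exact: m1.
by apply: (cvg_norm (c1 t Dt u)).
Qed.

Lemma caratheodory_max D h1 h2 : caratheodory D h1 -> caratheodory D h2 ->
  caratheodory D (fun t u => Num.max (h1 t u) (h2 t u)).
Proof.
move=> [m1 c1] [m2 c2]; split=> [u|t Dt u]; first exact: measurable_maxr.
by apply: continuous_max; [exact: c1|exact: c2].
Qed.

Lemma caratheodory_sum D (I : Type) (s : seq I) (h : I -> T -> 'rV[R]_n -> R) :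
  (forall i, caratheodory D (h i)) ->
  caratheodory D (fun t u => \sum_(i <- s) h i t u).
Proof.
move=> ch; split=> [u|t Dt].
  by apply: measurable_sum => i; exact: (ch i).1.
elim: s => [|i s IH] u.
  by under eq_fun do rewrite big_nil; exact: cst_continuous.
under eq_fun do rewrite big_cons.
by apply: continuousD; [exact: (ch i).2|exact: IH].
Qed.

Lemma caratheodory_cst D (m : T -> R) : measurable_fun D m ->
  caratheodory D (fun t _ => m t).
Proof. by move=> mm; split=> // t _; exact: cst_continuous. Qed.

Lemma caratheodory_continuous D (g : 'rV[R]_n -> R) : continuous g ->
  caratheodory D (fun _ => g).
Proof. by move=> cg; split=> // u; exact: measurable_cst. Qed.

(* The condition is witnessed by a rational ball meeting [U t] on which [h t]
   stays below [c - 1/k]; by continuity the bound need only be tested at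
   rational points. *)
Lemma measurable_exists_lt D U h c : measurable D -> weakly_measurable D U ->
  caratheodory D h ->
  measurable (D `&` [set t | exists2 u, U t u & h t u < c]).
Proof.
move=> mD mU [mh ch].
pose r k : R := k.+1%:R^-1.
have r0 k : 0 < r k by rewrite invr_gt0.
pose B (q : 'rV[rat]_n) k : set 'rV[R]_n := ball (map_mx ratr q : 'rV[R]_n) (r k).
pose F (qk : 'rV[rat]_n * nat) : set T :=
  (D `&` [set t | U t `&` B qk.1 qk.2 !=set0]) `&`
  \bigcap_(s : 'rV[rat]_n)
     (D `&` [set t | B qk.1 qk.2 (map_mx ratr s) ->
                     h t (map_mx ratr s) <= c - r qk.2]).
have -> : D `&` [set t | exists2 u, U t u & h t u < c] = \bigcup_qk F qk.
  apply/seteqP; split=> [t [Dt [u Uu huc]]|t [[q k] _ [/= [Dt [u [Uu Bu]]] Fs]]].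
  - have : h t v @[v --> u] --> h t u by exact: ch.
    have e0 : 0 < (c - h t u) / 2 by rewrite divr_gt0// subr_gt0.
    move=> /cvgrPdist_lt/(_ _ e0)/nbhs_ballP[e /= e1 eP].
    (* A radius [r k] below [e / 2] puts any such ball through [u] inside the [e]-ball; below half
       the gap it leaves room for the bound [c - r k]. *)
    have [k rk] : exists k, r k < Num.min (e / 2) ((c - h t u) / 2).
      have m0 : 0 < Num.min (e / 2) ((c - h t u) / 2).
        by rewrite lt_min e0 divr_gt0.
      have [k _ kP] := near_infty_natSinv_lt (PosNum m0).
      by exists k; exact: (kP k (leqnn _)).
    move: rk; rewrite lt_min => /andP[re rc].
    have [q qu] := rat_rV_dense R n u (r k) (r0 k).
    exists (q, k) => //; split => /=.
      split=> //; exists u; split => //.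
      by rewrite /B mx_norm_ball /ball_ /= distrC.
    move=> s _; split => //= Bs.
    have /eP : ball u e (map_mx ratr s).
      rewrite mx_norm_ball /ball_ /=.
      rewrite (le_lt_trans (ler_distD (map_mx ratr q) _ _))//.
      rewrite [ltRHS]splitr ltrD// ?(lt_trans qu)//.
      by move: Bs; rewrite /B mx_norm_ball /ball_ /= => Bs; rewrite (lt_trans Bs).
    rewrite ltr_distlC => /andP[_ hs].
    rewrite (le_trans (ltW hs))// lerBrDr.
    rewrite (le_trans (lerD (lexx _) (ltW rc)))//.
    by rewrite -addrA -splitr addrC subrK.
  - split => //; exists u => //.
    rewrite (@le_lt_trans _ _ (c - r k)) ?ltrBlDr ?ltrDl//.
    rewrite leNgt; apply/negP => hu.
    have : h t v @[v --> u] --> h t u by exact: ch.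
    move=> /(cvgr_gt (h t u)) /(_ _ hu).
    have oB : nbhs u (B q k) by apply: open_nbhs_nbhs; split=> //; exact: ball_open.
    move=> /(filterI oB)/nbhs_ballP[e /= e0 eP].
    have [s sP] := rat_rV_dense R n u e e0.
    have /eP[Bs] : ball u e (map_mx ratr s) by rewrite mx_norm_ball.
    have [_ /(_ Bs)] := Fs s I.
    by move=> /= le_hs; rewrite ltNge le_hs.
apply: countable_bigcupT_measurable => // -[q k]; apply: measurableI => /=.
  exact/mU/ball_open.
apply: countable_bigcapT_measurable => s.
(* Membership of the rational point in the ball does not depend on [t]: the condition is a sublevel
   set or vacuous. *)
have [Bs|nBs] := pselect (B q k (map_mx ratr s)).
  rewrite (_ : [set t | _] = (h^~ (map_mx ratr s)) @^-1` `]-oo, c - r k]%classic).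
    by apply: mh => //; exact: measurable_itv.
  by apply/seteqP; split => t /=; rewrite in_itv/=; [apply|].
rewrite (_ : [set t | _] = setT) ?setIT//.
by apply/seteqP; split => // t _ /=.
Qed.

(* On a ball, [h t] attains its minimum over the compact slice of [U t], so it
   vanishes there as soon as it takes arbitrarily small values. *)
Lemma measurable_exists_eq0 D U h : measurable D -> weakly_measurable D U ->
  (forall t, D t -> closed (U t)) -> caratheodory D h ->
  measurable (D `&` [set t | exists2 u, U t u & h t u = 0]).
Proof.
move=> mD mU clU ch.
(* [g k t] vanishes exactly at the zeros of [h t] in the closed ball of radius [k]; the truncation
   is a penalty, so [U] stays unchanged. *)
pose g k t u := `|h t u| + Num.max (`|u| - k%:R) 0.
have cg k : caratheodory D (g k).
  apply: caratheodoryD; first exact: caratheodory_norm.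
  apply: caratheodory_max.
    apply: caratheodory_continuous => u.
    by apply: continuousB; [exact: norm_continuous|exact: cst_continuous].
  by apply: caratheodory_continuous => u; exact: cst_continuous.
have -> : D `&` [set t | exists2 u, U t u & h t u = 0] =
  \bigcup_k \bigcap_i (D `&` [set t | exists2 u, U t u & g k t u < i.+1%:R^-1]).
  apply/seteqP; split => [t [Dt [u Uu hu]]|t [k _ kP]].
    have [k uk] : exists k : nat, `|u| <= k%:R.
      exists (Num.bound `|u|); apply: ltW.
      by have := archi_boundP (normr_ge0 u).
    exists k => // i _; split => //; exists u => //.
    by rewrite /g hu normr0 add0r max_r ?subr_le0// invr_gt0.
  have Dt : D t by have [] := kP 0%N I.
  split => //.
  (* A value of [g k t] below [1] forces norm at most [k + 1], so all near-zeros lie in [K]. *)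
  pose K := U t `&` [set u | `|u| <= k.+1%:R].
  have gK u i : g k t u < i.+1%:R^-1 -> `|u| <= k.+1%:R.
    move=> gu; rewrite -natr1 -lerBlDl.
    apply: (@le_trans _ _ (g k t u)).
      by rewrite /g ler_wpDl// le_max lexx.
    by rewrite (le_trans (ltW gu))// invf_le1// ler1n.
  have K0 : K !=set0.
    by have [_ [u Uu gu]] := kP 0%N I; exists u; split => //=; exact: gK gu.
  have cK : compact K.
    apply: bounded_closed_compact.
      by exists k.+1%:R; split; [exact: num_real|
        move=> x kx u [_ /= uk]; rewrite (le_trans uk)// ltW].
    apply: closedI; first exact: clU.
    apply: (@closed_comp _ _ (fun u : 'rV[R]_n => `|u|) [set x | x <= k.+1%:R]).
      by move=> u _; exact: norm_continuous.
    exact: closed_le.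
  have cgt : continuous (g k t) by exact: (cg k).2.
  have [u /[!inE] -[Uu uk] umin] := EVT_min_rV K0 cK (continuous_subspaceT cgt).
  exists u => //.
  have g0 : g k t u <= 0.
    rewrite leNgt; apply/negP => gu0.
    have [i _ iP] := near_infty_natSinv_lt (PosNum gu0).
    have /= gui := iP i (leqnn _).
    have [_ [v Uv gv]] := kP i I.
    have /umin : v \in K by rewrite inE; split => //=; exact: gK gv.
    by rewrite leNgt (lt_trans gv).
  apply/eqP; rewrite -normr_le0.
  by rewrite (le_trans _ g0)// /g lerDl le_max lexx orbT.
apply: bigcupT_measurable => k; apply: bigcapT_measurable => i.
exact: measurable_exists_lt.
Qed.

(** [m t <= c] holds exactly when [|h t u| + max (p t u - c) 0] has a zero in [U t], so sublevel
    sets of [m] are measurable by [measurable_exists_eq0]. *)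
Lemma measurable_min D U h p (m : T -> R) : measurable D ->
  weakly_measurable D U -> (forall t, D t -> closed (U t)) ->
  caratheodory D h -> caratheodory D p ->
  (forall t, D t -> exists2 u, U t u & h t u = 0 /\ p t u = m t) ->
  (forall t u, D t -> U t u -> h t u = 0 -> m t <= p t u) ->
  measurable_fun D m.
Proof.
move=> mD mU clU ch cp mex mle _.
apply: (measurability _ (RGenOInfty.measurableE R)) => // _ [_ [c ->] <-].
pose g t u := `|h t u| + Num.max (p t u - c) 0.
rewrite (_ : D `&` _ = D `\` (D `&` [set t | exists2 u, U t u & g t u = 0])).
  apply: measurableD => //; apply: measurable_exists_eq0 => //; apply: caratheodoryD.
    exact: caratheodory_norm.
  apply: caratheodory_max; last by apply: caratheodory_cst; exact: measurable_cst.
  apply: caratheodoryB => //; apply: caratheodory_cst; exact: measurable_cst.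
apply/seteqP; split => t /= [Dt]; rewrite ?in_itv/= ?andbT => mc; split=> //.
  move=> [_ [u Uu /eqP]]; rewrite paddr_eq0// ?le_max ?lexx ?orbT// normr_eq0.
  move=> /andP[/eqP hu /eqP pc]; move: mc; rewrite ltNge => /negP; apply.
  rewrite (le_trans (mle t u Dt Uu hu))// -subr_le0 -pc.
  by rewrite le_max lexx.
rewrite ?in_itv/= ?andbT ltNge; apply: contra_notN mc => mc; split => //.
have [u Uu [hu pu]] := mex t Dt; exists u => //.
by rewrite /g hu normr0 add0r pu max_r ?subr_le0.
Qed.

(** This is [measurable_exists_lt] for the single-valued multifunction [[set z t]]. *)
Lemma measurable_caratheodory_comp D h (z : T -> 'rV[R]_n) : measurable D ->
  (forall O, open O -> measurable (D `&` z @^-1` O)) -> caratheodory D h ->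
  measurable_fun D (fun t => h t (z t)).
Proof.
move=> mD mz ch _.
apply: (measurability _ (RGenInftyO.measurableE R)) => // _ [_ [c ->] <-].
rewrite (_ : _ `&` _ = D `&` [set t | exists2 u, [set z t] u & h t u < c]).
  apply: measurable_exists_lt => // O oO.
  rewrite (_ : [set t | _] = z @^-1` O); first exact: mz.
  by apply/seteqP; split => t /=; [move=> [_ [-> //]]|exists (z t)].
apply/seteqP; split => t /= [Dt].
  by rewrite in_itv/= => hc; split=> //; exists (z t).
by move=> [_ -> hc]; split => //; rewrite in_itv.
Qed.

(** For the converse, an open set is a countable union of rational balls, and balls of the max norm
    are boxes, hence given by conditions on single coordinates. *)
Lemma vector_measurableP D (z : T -> 'rV[R]_n) : measurable D ->
  (forall O, open O -> measurable (D `&` z @^-1` O)) <->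
  (forall i, measurable_fun D (fun t => z t 0 i)).
Proof.
move=> mD; split=> [mz i _ | mz O oO].
  apply: (measurability _ (RGenInftyO.measurableE R)) => // _ [_ [c ->] <-].
  rewrite -[X in measurable (_ `&` X)]/
    (z @^-1` ((fun u : 'rV[R]_n => u 0 i) @^-1` `]-oo, c[%classic)).
  apply: mz; apply: open_comp => [u _|]; last exact: interval_open.
  exact: coord_continuous.
pose r k : R := k.+1%:R^-1.
have r0 k : 0 < r k by rewrite invr_gt0.
pose B (q : 'rV[rat]_n) k : set 'rV[R]_n := ball (map_mx ratr q : 'rV[R]_n) (r k).
pose F (qk : 'rV[rat]_n * nat) : set T :=
  if `[< B qk.1 qk.2 `<=` O >] then D `&` z @^-1` (B qk.1 qk.2) else set0.
have -> : D `&` z @^-1` O = \bigcup_qk F qk.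
  apply/seteqP; split=> [t [Dt Ot]|t [[q k] _]]; last first.
    by rewrite /F /=; case: asboolP => // BO [Dt /BO].
  have := open_nbhs_nbhs (conj oO Ot).
  move=> /nbhs_ballP[e /= e0 eP].
  have e20 : 0 < e / 2 by rewrite divr_gt0.
  have [k _ kP] := near_infty_natSinv_lt (PosNum e20).
  have /= {}kP := kP k (leqnn _).
  have [q qu] := rat_rV_dense R n (z t) (r k) (r0 k).
  exists (q, k) => //; rewrite /F /=; case: asboolP => [_|[]].
    by split=> //=; rewrite /B mx_norm_ball /ball_ /= distrC.
  move=> v; rewrite /B mx_norm_ball /ball_ /= => vq.
  apply: eP; rewrite mx_norm_ball /ball_ /=.
  rewrite (le_lt_trans (ler_distD (map_mx ratr q) _ _))//.
  by rewrite [ltRHS]splitr ltrD// ?(lt_trans qu)// (lt_trans vq).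
apply: countable_bigcupT_measurable => // -[q k]; rewrite /F /=.
case: ifP => // _.
have -> : D `&` z @^-1` B q k = D `&` \bigcap_(i : 'I_n)
    (D `&` [set t | `|ratr (q 0 i) - z t 0 i| < r k]).
  apply/seteqP; split => t /= [Dt]; rewrite /B.
    by move=> [_ Bz]; split=> // i _; split => //; have := Bz 0 i; rewrite mxE.
  move=> Bz; split=> //; split=> // j i; rewrite ord1 mxE.
  by have [_] := Bz i I.
apply: measurableI => //; apply: countable_bigcapT_measurable => i.
have mh : measurable_fun D (fun t => `|ratr (q 0 i) - z t 0 i|).
  apply: (measurableT_comp (@normr_measurable R setT)).
  by apply: measurable_funB => //; exact: mz.
rewrite (_ : [set t | _] =
    (fun t => `|ratr (q 0 i) - z t 0 i|) @^-1` `]-oo, r k[%classic).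
  by apply: mh.
by apply/seteqP; split => t /=; rewrite in_itv.
Qed.

End caratheodory_functions.

(** * Minimisation and measurable selection *)

Lemma bounded_sublevel_min (R : realType) (n : nat) (Z : set 'rV[R]_n)
    (p : 'rV[R]_n -> R) (u0 : 'rV[R]_n) (b : R) : closed Z -> continuous p ->
  Z u0 -> (forall u, Z u -> p u <= p u0 -> `|u| <= b) ->
  exists2 u, Z u & forall v, Z v -> p u <= p v.
Proof.
(* Outside [K] the values on [Z] exceed [p u0], so a minimum over the compact [K] is one over
   [Z]. *)
move=> cZ cp Zu0 bZ; pose K := Z `&` [set u | p u <= p u0].
have K0 : K !=set0 by exists u0; split => /=.
have cK : compact K.
  apply: bounded_closed_compact.
    exists b; split; first exact: num_real.
    by move=> x bx u [Zu pu] /=; rewrite (le_trans (bZ _ Zu pu))// ltW.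
  apply: closedI => //.
  apply: (@closed_comp _ _ p [set x | x <= p u0]); last exact: closed_le.
  by move=> u _; exact: cp.
have [u /[!inE] -[Zu pu] umin] := EVT_min_rV K0 cK (continuous_subspaceT cp).
exists u => // v Zv; have [pv|pv] := leP (p v) (p u0).
  by apply: umin; rewrite inE.
exact: le_trans pu (ltW pv).
Qed.

Section measurable_selection.
Context {d : measure_display} {T : measurableType d} {R : realType} {n : nat}.
Variables (D : set T) (U : T -> set 'rV[R]_n).
Hypotheses (mD : measurable D) (mU : weakly_measurable D U)
  (clU : forall t, D t -> closed (U t)).
Implicit Types h p : T -> 'rV[R]_n -> R.

(** All constraints imposed so far are kept in one scalar equation, so that each refinement is again
    given by a Caratheodory function. *)
Let zeros h t := U t `&` [set u | h t u = 0].

Let closed_zeros h t : caratheodory D h -> D t -> closed (zeros h t).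
Proof.
move=> ch Dt; apply: closedI; first exact: clU.
apply: (@closed_comp _ _ (h t) [set 0]); last exact: closed_eq.
by move=> u _; exact: ch.2.
Qed.

(** The minimisers are again a zero set, that of [|h| + |p - m|], with [m] measurable by
    [measurable_min]; this lets minimisations be iterated. *)
Let argmin_zeros h p : caratheodory D h -> caratheodory D p ->
  (forall t, D t -> exists2 u, zeros h t u & forall v, zeros h t v -> p t u <= p t v) ->
  exists h' m, [/\ caratheodory D h', measurable_fun D m,
    (forall t, D t -> zeros h' t !=set0) &
    forall t u, D t -> zeros h' t u -> zeros h t u /\ p t u = m t].
Proof.
move=> ch cp pmin.
(* This choice may fail to be measurable; it only names the minimal value, and [0] is a default off
   [D]. *)
have /choice[u uP] : forall t, exists u, D t ->
    zeros h t u /\ forall v, zeros h t v -> p t u <= p t v.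
  move=> t; have [Dt|nDt] := pselect (D t); last by exists 0.
  by have [u ? ?] := pmin t Dt; exists u.
pose m t := p t (u t).
have mm : measurable_fun D m.
  apply: (@measurable_min _ _ _ _ D U h p) => //.
    by move=> t Dt; have [[? ?] _] := uP t Dt; exists (u t).
  by move=> t v Dt Uv hv; have [_] := uP t Dt; apply.
exists (fun t u => `|h t u| + `|p t u - m t|), m; split => //.
- apply: caratheodoryD; apply: caratheodory_norm => //.
  by apply: caratheodoryB => //; exact: caratheodory_cst.
- move=> t Dt; have [[Uu hu] _] := uP t Dt; exists (u t); split => //=.
  by rewrite hu subrr !normr0 addr0.
- move=> t v Dt [Uv /= /eqP]; rewrite paddr_eq0// !normr_eq0 subr_eq0.
  by move=> /andP[/eqP hv /eqP pv]; split.
Qed.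

(** Minimising a coordinate fixes its value at each [t] on all later zero sets, which only shrink;
    the bound [b] makes each minimum attained. *)
Let constant_coordinates h (b : T -> R) (s : seq 'I_n) : caratheodory D h ->
  (forall t, D t -> zeros h t !=set0) ->
  (forall t u, D t -> zeros h t u -> `|u| <= b t) ->
  exists h', [/\ caratheodory D h', forall t, D t -> zeros h' t !=set0,
    forall t u, D t -> zeros h' t u -> zeros h t u &
    forall i, i \in s -> exists2 m, measurable_fun D m &
      forall t u, D t -> zeros h' t u -> u 0 i = m t].
Proof.
move=> + + bh.
(* This triviality is generalised to zeros of [g] lying among those of [h], so the bound [b]
   survives the induction. *)
have : forall t u, D t -> zeros h t u -> zeros h t u by [].
elim: s {-2}h => [|i s IH] g gh cg g0; first by exists g.
have cp : caratheodory D (fun (_ : T) (u : 'rV[R]_n) => u 0 i).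
  by apply: caratheodory_continuous; exact: coord_continuous.
have [|g1 [m [cg1 mm g10 g1P]]] := argmin_zeros g _ cg cp.
  move=> t Dt; have [u0 gu0] := g0 t Dt.
  apply: (bounded_sublevel_min R n (zeros g t) _ u0 (b t)) => //.
  - exact: closed_zeros.
  - exact: coord_continuous.
  - by move=> u /(gh t u Dt) /(bh t u Dt).
have [|//|//|g2 [cg2 g20 g21 g2P]] := IH g1.
  by move=> t u Dt /(g1P t u Dt)[/(gh t u Dt)].
exists g2; split => //.
  by move=> t u Dt /(g21 t u Dt)/(g1P t u Dt)[].
move=> j; rewrite inE => /predU1P[->|/g2P//].
by exists m => // t u Dt /(g21 t u Dt)/(g1P t u Dt)[].
Qed.

(* Minimise [`|u|] and then the coordinates of [u] one after the other: each
   minimum is a measurable function of [t] and what remains is a single point. *)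
Lemma measurable_selection h : caratheodory D h ->
  (forall t, D t -> exists2 u, U t u & h t u = 0) ->
  exists u : T -> 'rV[R]_n, (forall i, measurable_fun D (fun t => u t 0 i)) /\
    forall t, D t -> U t (u t) /\ h t (u t) = 0.
Proof.
move=> ch h0.
have cp : caratheodory D (fun (_ : T) (u : 'rV[R]_n) => `|u|).
  by apply: caratheodory_continuous => u; exact: norm_continuous.
have [|h1 [b [ch1 _ h10 h1P]]] := argmin_zeros h _ ch cp.
  move=> t Dt; have [u0 Uu0 hu0] := h0 t Dt.
  apply: (bounded_sublevel_min R n (zeros h t) _ u0 `|u0|) => //.
  - exact: closed_zeros.
  - by move=> u; exact: norm_continuous.
have [|h2 [ch2 h20 h21 h2P]] := constant_coordinates h1 b (enum 'I_n) ch1 h10.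
  by move=> t u Dt /(h1P t u Dt)[_ ->].
have /choice[u uP] : forall t, exists u, D t -> zeros h2 t u.
  move=> t; have [Dt|nDt] := pselect (D t); last by exists 0.
  by have [u ?] := h20 t Dt; exists u.
exists u; split=> [i|t Dt].
  have [|m mm mP] := h2P i; first by rewrite mem_enum.
  apply: eq_measurable_fun mm => t; rewrite inE => Dt.
  by rewrite (mP t _ Dt (uP t Dt)).
by have [[]] := h1P t _ Dt (h21 t _ Dt (uP t Dt)).
Qed.

End measurable_selection.

(** * Lebesgue measurability and null sets *)

Section lebesgue_measurability.
Context {R : realType}.
Implicit Types D G : set (lebT R).

Lemma borel_lebesgue_measurable (A : set R) :
  measurable A -> measurable (A : set (lebT R)).
Proof. exact: sub_caratheodory. Qed.

Lemma lebesgue_measurable_itv (i : interval R) :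
  measurable ([set` i] : set (lebT R)).
Proof. by apply: borel_lebesgue_measurable; exact: measurable_itv. Qed.

Lemma continuous_lebesgue_measurable D (g : R -> R) : continuous g ->
  measurable_fun D (g : lebT R -> R).
Proof.
move=> cg; apply: (measurable_funS _ (@subsetT _ D)) => // _ Y mY.
apply: borel_lebesgue_measurable.
exact: (@continuous_measurable_fun _ g cg).
Qed.

Lemma negligible_lebesgue_set1 (t : R) :
  (leb R).-negligible ([set t] : set (lebT R)).
Proof.
apply/negligibleP; first by apply: borel_lebesgue_measurable; exact: measurable_set1.
exact: (@lebesgue_measure_set1 R t).
Qed.

(** Completeness makes every subset of the null difference measurable, whatever [g] does there. *)
Lemma lebesgue_measurable_funS d (T : measurableType d) G D (g : lebT R -> T) :
  G `<=` D -> (leb R).-negligible (D `\` G) ->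
  measurable_fun G g -> measurable G -> measurable_fun D g.
Proof.
move=> GD nDG mg mG mD Y mY.
rewrite (_ : D `&` _ = (G `&` g @^-1` Y) `|` ((D `\` G) `&` g @^-1` Y)).
  apply: measurableU; first exact: mg.
  apply: completed_lebesgue_measure_is_complete.
  by apply: negligibleS nDG; exact: subIsetl.
rewrite -setIUl; congr (_ `&` _).
by rewrite setUDr setDv setD0 setUC; apply/esym/setUidPl.
Qed.

(** Lets almost everywhere conditions be used pointwise: the good times form a measurable set
    because the rest of the half-line is null and the measure complete. *)
Lemma ae_itv_core (t0 : R) (P : lebT R -> Prop) :
  {ae leb R, forall t : lebT R, `[t0, +oo[%classic t -> P t} ->
  exists2 G : set (lebT R), measurable G &
    [/\ G `<=` `[t0, +oo[%classic, (leb R).-negligible (`[t0, +oo[ `\` G) &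
        forall t, G t -> t0 < t /\ P t].
Proof.
move=> aeP; pose D : set (lebT R) := `[t0, +oo[%classic.
pose G : set (lebT R) := [set t | t0 < t /\ P t].
have GD : G `<=` D by move=> t [tt0 _]; rewrite /D /= in_itv/= andbT ltW.
have nDG : (leb R).-negligible (D `\` G).
  apply: negligibleS (negligibleU (negligible_lebesgue_set1 t0) aeP).
  move=> t [Dt nG]; have [->|tt0] := eqVneq t t0; first by left.
  right => /= /(_ Dt) Pt; apply: nG; split => //.
  by rewrite lt_neqAle eq_sym tt0; move: Dt; rewrite /D /= in_itv/= andbT.
exists G; last by split.
rewrite (_ : G = D `\` (D `\` G)); last by rewrite setDD; apply/esym/setIidPr.
apply: measurableD; first exact: lebesgue_measurable_itv.
exact: completed_lebesgue_measure_is_complete.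
Qed.

End lebesgue_measurability.

(** * Measurability of trajectories and velocities *)

Section trajectory_measurability.
Context {R : realType} {N : nat}.
Variables (t0 : R) (x : R -> 'rV[R]_N).
Hypothesis x_ac : loc_abs_cont t0 x.

(** Freezing [x] at its initial value before [t0], where nothing is known of it, gives a function
    continuous on the whole line. *)
Let y t := x (Num.max t0 t).

Let y_continuous : continuous y.
Proof.
move=> t; apply/cvgrPdist_lt => e e0.
(* One unit past [max t0 t] leaves room for every [s] within distance [1] of [t]. *)
have T0 : t0 < Num.max t0 t + 1 by rewrite ltr_pwDr// le_max lexx.
have [r r0 rP] := x_ac _ T0 e e0.
have m0 : 0 < Num.min r 1 by rewrite lt_min r0 ltr01.
near=> s.
have : `|t - s| < Num.min r 1.
  near: s; have := @cvg_id _ (nbhs t).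
  by move=> /cvgrPdist_lt/(_ _ m0).
rewrite lt_min => /andP[tsr ts1].
pose a := Num.max t0 t; pose b := Num.max t0 s.
have bT : b <= a + 1.
  rewrite ge_max (ltW T0)/=; move: ts1; rewrite ltr_distlC => /andP[_ /ltW].
  by move=> /le_trans; apply; rewrite lerD2r le_max lexx orbT.
have mM : Num.min a b <= Num.max a b by have [|/ltW] := leP a b.
(* Clamping at [t0] does not increase distances. *)
have ab : Num.max a b - Num.min a b < r.
  apply: le_lt_trans tsr; rewrite -[leLHS]ger0_norm; last first.
    by rewrite subr_ge0.
  rewrite /a /b; have [t0t|tt0] := leP t0 t; have [t0s|st0] := leP t0 s.
  - have [ts|st] := leP t s; first by rewrite distrC.
    by [].
  - rewrite max_l ?min_r// ?(ltW st0)//.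
    rewrite !ger0_norm ?subr_ge0// ?lerD2l ?lerN2; first by rewrite ltW.
    by rewrite (le_trans (ltW st0)).
  - rewrite max_r ?min_l// ?(ltW tt0)// [leRHS]distrC.
    rewrite !ger0_norm ?subr_ge0// ?lerD2l ?lerN2; first by rewrite ltW.
    by rewrite (le_trans (ltW tt0)).
  - by rewrite maxxx minxx subrr normr0.
have := rP 1%N (fun=> Num.min a b) (fun=> Num.max a b).
rewrite !big_ord1 => /(_ _ _ ab) xab.
suff: `|x (Num.max a b) - x (Num.min a b)| < e.
  by rewrite /y -/a -/b; have [_|_] := leP a b => //; rewrite distrC.
apply: xab => [_ _|i j].
  split; first by rewrite le_min /a /b !le_max !lexx.
  split => //.
  by rewrite ge_max bT lerDl ler01.
by case: i => //; case: j.
Unshelve. all: by end_near. Qed.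

Let yi_continuous i : continuous (fun t => y t 0 i).
Proof.
move=> t; apply: (@continuous_comp _ _ _ y (fun u : 'rV[R]_N => u 0 i)).
  exact: y_continuous.
exact: coord_continuous.
Qed.

Lemma trajectory_measurable (G : set (lebT R)) i : G `<=` `[t0, +oo[%classic ->
  measurable_fun G ((fun t => x t 0 i) : lebT R -> R).
Proof.
move=> GD; apply: (@eq_measurable_fun _ _ _ _ G (fun t => y t 0 i)).
  move=> t; rewrite inE => /GD /=; rewrite in_itv/= andbT => t0t.
  by rewrite /y max_r.
exact: continuous_lebesgue_measurable.
Qed.

(** The velocity is the pointwise limit of difference quotients of the continuous [y] with steps
    [1/(k+1)]. *)
Lemma velocity_measurable (G : set (lebT R)) i :
  (forall t, G t -> t0 < t /\ derivable x t 1) ->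
  measurable_fun G ((fun t => ('D_1 x t) 0 i) : lebT R -> R).
Proof.
move=> GP.
pose q (k : nat) t := k.+1%:R^-1^-1 * (y (k.+1%:R^-1 + t) 0 i - y t 0 i).
apply: (@measurable_fun_cvg _ _ _ _ (q : nat -> lebT R -> R)).
  move=> k; apply: continuous_lebesgue_measurable => t.
  apply: cvgM; first exact: cvg_cst.
  apply: cvgB; last exact: yi_continuous.
  apply: (@cvg_comp _ _ _ (fun t => k.+1%:R^-1 + t) (fun t => y t 0 i) _
    (nbhs (k.+1%:R^-1 + t))); last exact: yi_continuous.
  by apply: cvgD; [exact: cvg_cst|exact: cvg_id].
move=> t /GP[t0t dx].
pose F (h : R) := (h^-1 *: ((x \o shift t) (h *: (1 : R)) - x t)) 0 i.
have : F h @[h --> 0^'] --> ('D_1 x t) 0 i.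
  have {}dx : h^-1 *: ((x \o shift t) (h *: (1 : R)) - x t) @[h --> 0^'] -->
    'D_1 x t by exact: dx.
  exact: (cvg_comp _ _ dx (@coord_continuous _ _ _ 0 i _)).
move=> /cvgr_dnbhsP/(_ (fun k => k.+1%:R^-1)).
have -> : (fun k => F k.+1%:R^-1) = q ^~ t.
  (* The steps are positive, so both sample points lie to the right of [t0], where [y] equals
     [x]. *)
  apply/funext => k; rewrite /F /q /y !mxE /=.
  rewrite max_r; last by rewrite (le_trans (ltW t0t))// lerDr invr_ge0.
  by rewrite max_r ?(ltW t0t)// /GRing.scale /= mulr1.
by apply; split; [move=> k; rewrite invr_eq0 pnatr_eq0|exact: cvg_harmonic].
Qed.

End trajectory_measurability.

(** * Comparison and finiteness of integrals *)

Lemma ae_le_integral (d : measure_display) (T : measurableType d)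
    (R : realType) (mu : {measure set T -> \bar R}) (D : set T)
    (g1 g2 : T -> \bar R) : measurable D ->
  measurable_fun D g1 -> measurable_fun D g2 ->
  {ae mu, forall t, D t -> (g1 t <= g2 t)%E} ->
  (\int[mu]_(t in D) g1 t <= \int[mu]_(t in D) g2 t)%E.
Proof.
(* Positive parts increase and negative parts decrease from [g1] to [g2]; subtraction in [\bar R]
   respects this even at infinity. *)
move=> mD m1 m2 g12; rewrite integralE [leRHS]integralE; apply: leeB.
  apply: ae_ge0_le_integral => //; try exact: measurable_funepos.
  apply: filterS g12 => t g12 Dt.
  by apply: (@funepos_le _ _ [set t]); rewrite ?inE// => s /[!inE] ->; exact: g12.
apply: ae_ge0_le_integral => //; try exact: measurable_funeneg.
apply: filterS g12 => t g12 Dt.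
by apply: (@funeneg_le _ _ [set t]); rewrite ?inE// => s /[!inE] ->; exact: g12.
Qed.

(** The negative part is dominated by [|psi|], whose integral is finite. *)
Lemma integral_well_defined_ge (R : realType) (t0 : R) (g : R -> \bar R)
    (psi : R -> R) : 0 <= t0 -> L1_pos psi ->
  measurable_fun (`[t0, +oo[%classic : set (lebT R)) (g : lebT R -> \bar R) ->
  (forall t, t0 <= t -> ((psi t)%:E <= g t)%E) ->
  integral_well_defined t0 g.
Proof.
move=> t00 /integrableP[mpsi ipsi] mg psig; split => //.
have D0 : (`[t0, +oo[%classic : set (lebT R)) `<=` `[0, +oo[%classic.
  by move=> t /=; rewrite !in_itv/= !andbT; exact: le_trans.
apply: le_lt_trans ipsi.
apply: (@le_trans _ _ (\int[leb R]_(t in (`[t0, +oo[%classic : set (lebT R)))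
    `|(psi t)%:E|)%E); last first.
  apply: ge0_subset_integral D0.
  - exact: lebesgue_measurable_itv.
  - exact: lebesgue_measurable_itv.
  - exact: measurableT_comp mpsi.
  - by move=> t _; exact: abse_ge0.
apply: ge0_le_integral.
- exact: lebesgue_measurable_itv.
- by move=> t _; exact: funeneg_ge0.
- exact: measurable_funeneg.
- apply: measurableT_comp; first exact: abse_measurable.
  by apply: (measurable_funS _ D0 mpsi); exact: lebesgue_measurable_itv.
- move=> t /=; rewrite in_itv/= andbT => /psig psit.
  rewrite funenegE ge_max lee_fin normr_ge0 andbT leeNl.
  by apply: le_trans psit; rewrite -EFinN lee_fin lerNl -normrN ler_norm.
Qed.

(** * Matching trajectories and controls *)

Section representation.
Context {R : realType} {N M : nat}.
Variables (A : set 'rV[R]_N) (U : R -> set 'rV[R]_M)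
  (H : R -> 'rV[R]_N -> 'rV[R]_N -> R)
  (f : R -> 'rV[R]_N -> 'rV[R]_M -> 'rV[R]_N)
  (l : R -> 'rV[R]_N -> 'rV[R]_M -> R) (phi phi1 : R -> R).
Hypotheses (U_meas : setval_measurable U)
  (U_closed : forall t, 0 <= t -> closed (U t))
  (phi_L1 : L1_pos phi) (H_phi : forall t x, 0 <= t -> H t x 0 <= - phi t)
  (f_meas : forall x u,
    vmeasurable (`[0, +oo[%classic : set (lebT R)) (fun t => f t x u))
  (l_meas : forall x u, measurable_fun (`[0, +oo[%classic : set (lebT R))
    ((fun t => l t x u) : lebT R -> R))
  (f_cont : forall t, 0 <= t ->
    continuous (fun xu : 'rV[R]_N * 'rV[R]_M => f t xu.1 xu.2))
  (l_cont : forall t, 0 <= t ->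
    continuous (fun xu : 'rV[R]_N * 'rV[R]_M => l t xu.1 xu.2))
  (phi1_L1 : L1_pos phi1) (l_phi1 : forall t x u, 0 <= t -> phi1 t <= l t x u)
  (epi : epi_representation H U f l).
Variables (t0 : R) (x0 : 'rV[R]_N).
Hypothesis t0_ge0 : 0 <= t0.

Let D : set (lebT R) := `[t0, +oo[%classic.

Let mD : measurable D. Proof. exact: lebesgue_measurable_itv. Qed.

Let D_ge0 t : D t -> 0 <= t.
Proof. by rewrite /D /= in_itv/= andbT; exact: le_trans. Qed.

Let D_sub : D `<=` `[0, +oo[%classic.
Proof. by move=> t /D_ge0; rewrite /= in_itv/= andbT. Qed.

Let measurable_in_time (g : lebT R -> R) (G : set (lebT R)) : G `<=` D ->
  measurable_fun (`[0, +oo[%classic : set (lebT R)) g -> measurable_fun G g.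
Proof.
move=> GD; apply: measurable_funS; first exact: lebesgue_measurable_itv.
exact: subset_trans GD D_sub.
Qed.

(** For fixed [u], measurability comes from inserting the measurable trajectory into a function that
    is Caratheodory in the state. *)
Let caratheodory_along (g : R -> 'rV[R]_N -> 'rV[R]_M -> R)
    (x : R -> 'rV[R]_N) (G : set (lebT R)) :
  loc_abs_cont t0 x -> measurable G -> G `<=` D ->
  (forall y u, measurable_fun (`[0, +oo[%classic : set (lebT R))
    ((fun t => g t y u) : lebT R -> R)) ->
  (forall t, 0 <= t ->
    continuous (fun xu : 'rV[R]_N * 'rV[R]_M => g t xu.1 xu.2)) ->
  caratheodory G (fun t u => g t (x t) u).
Proof.
move=> x_ac mG GD mg cg; split=> [u|t Gt u]; last first.
  apply: (@cvg_comp _ _ _ (fun u => (x t, u))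
    (fun xu : 'rV[R]_N * 'rV[R]_M => g t xu.1 xu.2) _ (nbhs (x t, u))).
    apply: (@cvg_pair _ _ _ (nbhs u) (nbhs (x t)) (nbhs u) _ _ _ (fun=> x t) id).
      exact: cvg_cst.
    exact: cvg_id.
  exact: (cg t (D_ge0 _ (GD _ Gt)) (x t, u)).
apply: (@measurable_caratheodory_comp _ (lebT R) R N G (fun t z => g t z u) x mG).
  apply/(@vector_measurableP _ (lebT R) R N G x mG) => i.
  exact: (trajectory_measurable t0 x x_ac).
split=> [z|t Gt z]; first exact: measurable_in_time.
apply: (@cvg_comp _ _ _ (fun z => (z, u))
    (fun xu : 'rV[R]_N * 'rV[R]_M => g t xu.1 xu.2) _ (nbhs (z, u))).
  apply: (@cvg_pair _ _ _ (nbhs z) (nbhs z) (nbhs u) _ _ _ id (fun=> u)).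
    exact: cvg_id.
  exact: cvg_cst.
exact: (cg t (D_ge0 _ (GD _ Gt)) (z, u)).
Qed.

Let f_coord_meas i y u : measurable_fun (`[0, +oo[%classic : set (lebT R))
  ((fun t => f t y u 0 i) : lebT R -> R).
Proof.
have m0 : measurable (`[0, +oo[%classic : set (lebT R)).
  exact: lebesgue_measurable_itv.
by move/(@vector_measurableP _ (lebT R) R N _ _ m0) : (f_meas y u); exact.
Qed.

Let f_coord_cont i t : 0 <= t ->
  continuous (fun xu : 'rV[R]_N * 'rV[R]_M => f t xu.1 xu.2 0 i).
Proof.
move=> t_ge0 xu.
exact: (cvg_comp _ _ (f_cont t t_ge0 xu) (@coord_continuous _ _ _ 0 i _)).
Qed.

Let Hstar_ge t x v : 0 <= t -> ((phi t)%:E <= Hstar H t x v)%E.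
Proof.
move=> t_ge0; apply: (@le_trans _ _ (dotv v 0 - H t x 0)%:E).
  rewrite /dotv trmx0 mulmx0 mxE sub0r lee_fin lerNr; exact: H_phi.
by apply: ereal_sup_ubound; exists 0.
Qed.

Let Hstar_rep t x v : 0 <= t -> (Hstar H t x v < +oo)%E ->
  exists2 u, U t u & f t x u = v /\ l t x u = fine (Hstar H t x v).
Proof.
move=> t_ge0 /((epi t x t_ge0).1 v)[u Uu [fu lu]]; exists u => //; split => //.
by rewrite -lu.
Qed.

(* [Hstar] along a trajectory is the attained minimum of the running cost over
   the controls producing the given velocity, whence its measurability. *)
Lemma trajectory_control x : S_H A H t0 x0 x ->
  measurable_fun D ((fun t => Hstar H t (x t) ('D_1 x t)) : lebT R -> \bar R) /\
  exists2 u, S_f A U f t0 x0 (x, u) &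
    {ae leb R, forall t : lebT R, D t ->
      Hstar H t (x t) ('D_1 x t) = (l t (x t) (u t))%:E}.
Proof.
move=> [x_ac aex xt0 xA].
(* All selection is done on [G], where differentiability and finiteness hold at every time;
   completeness carries measurability back to [D]. *)
have [G mG [GD nDG GP]] := ae_itv_core _ _ aex.
have G_ge0 t : G t -> 0 <= t by move=> /GD; exact: D_ge0.
have mUG : weakly_measurable G U.
  move=> O oO; rewrite (_ : _ `&` _ =
      G `&` [set t | 0 <= t /\ (U t `&` O) !=set0]).
    by apply: measurableI => //; exact: U_meas.
  apply/seteqP; split=> t /= [Gt]; first by split=> //; split=> //; exact: G_ge0.
  by move=> [_ UO].
have clU t : G t -> closed (U t) by move=> /G_ge0; exact: U_closed.
pose p t u := l t (x t) u.
have cp : caratheodory G (p : lebT R -> _) by exact: caratheodory_along.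
(* The velocity constraint becomes one scalar Caratheodory equation, assembled from the
   coordinates. *)
pose h t u := \sum_i `|f t (x t) u 0 i - ('D_1 x t) 0 i|.
have ch : caratheodory G (h : lebT R -> _).
  apply: caratheodory_sum => i; apply: caratheodory_norm; apply: caratheodoryB.
    by apply: (caratheodory_along (fun t y u => f t y u 0 i)) => //; exact: f_coord_cont.
  apply: (@caratheodory_cst _ (lebT R) R M G (fun t => ('D_1 x t) 0 i)).
  by apply: (velocity_measurable t0) => // t /GP[? []].
have h0 t u : h t u = 0 <-> f t (x t) u = 'D_1 x t.
  split=> [/eqP|fu]; last by apply: big1 => i _; rewrite fu subrr normr0.
  rewrite psumr_eq0// => /allP hu; apply/rowP => i.
  by have := hu i (mem_index_enum i); rewrite normr_eq0 subr_eq0 => /eqP.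
pose m t := fine (Hstar H t (x t) ('D_1 x t)).
have HmE t : G t -> Hstar H t (x t) ('D_1 x t) = (m t)%:E.
  move=> Gt; have [_ [_ Hoo]] := GP t Gt.
  have [u Uu [_ lu]] := (epi t (x t) (G_ge0 _ Gt)).1 _ Hoo.
  by rewrite /m -lu.
have m_ex t : G t -> exists2 u, U t u & h t u = 0 /\ p t u = m t.
  move=> Gt; have [_ [_ Hoo]] := GP t Gt.
  have [u Uu [fu lu]] := Hstar_rep _ _ _ (G_ge0 _ Gt) Hoo.
  by exists u => //; split => //; exact/h0.
(* The first inclusion attains [m t], as in [m_ex]; the second bounds the running cost below by
   it. *)
have mm : measurable_fun G (m : lebT R -> R).
  apply: (@measurable_min _ (lebT R) R M G U h p) => // t u Gt Uu /h0 fu.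
  by rewrite -lee_fin -HmE// -fu; exact: (epi t (x t) (G_ge0 _ Gt)).2.
have mH : measurable_fun G
    ((fun t => Hstar H t (x t) ('D_1 x t)) : lebT R -> \bar R).
  apply: (@eq_measurable_fun _ _ _ _ G (EFin \o (m : lebT R -> R))).
    by move=> t; rewrite inE => Gt; rewrite HmE.
  exact/measurable_EFinP.
split; first exact: (lebesgue_measurable_funS _ _ _ _ _ GD nDG mH mG).
(* One equation now encodes both the velocity and the minimal running cost. *)
pose h' t u := h t u + `|p t u - m t|.
have h'0 t u : h' t u = 0 <-> h t u = 0 /\ p t u = m t.
  split=> [/eqP|[hu pu]]; last by rewrite /h' hu pu subrr normr0 addr0.
  rewrite paddr_eq0 ?sumr_ge0// normr_eq0 subr_eq0.
  by move=> /andP[/eqP ? /eqP].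
have ch' : caratheodory G (h' : lebT R -> _).
  apply: (caratheodoryD G h _ ch); apply: caratheodory_norm.
  apply: (caratheodoryB G p _ cp).
  exact: (@caratheodory_cst _ (lebT R) R M G m).
have [|u [mu uP]] := @measurable_selection _ (lebT R) R M G U mG mUG clU h' ch'.
  by move=> t /m_ex[u Uu /h'0 hu]; exists u.
have aeG (P : lebT R -> Prop) : (forall t, G t -> P t) ->
    {ae leb R, forall t : lebT R, D t -> P t}.
  move=> GPt; apply: negligibleS nDG => t /= /not_implyP[Dt nPt].
  by split=> // /GPt.
exists u; last first.
  apply: aeG => t Gt; rewrite HmE//.
  by have [_ /h'0[_ <-]] := uP t Gt.
split => //=.
  apply/(@vector_measurableP _ (lebT R) R M D u mD) => i.
  exact: (lebesgue_measurable_funS _ _ _ _ _ GD nDG (mu i) mG).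
apply: aeG => t Gt; have [_ [dx _]] := GP t Gt.
by have [Uu /h'0[/h0 fu _]] := uP t Gt; split.
Qed.

Lemma cost_measurable x u : S_f A U f t0 x0 (x, u) ->
  measurable_fun D ((fun t => (l t (x t) (u t))%:E) : lebT R -> \bar R).
Proof.
move=> [/= x_ac u_meas _ _ _]; apply/measurable_EFinP.
apply: (@measurable_caratheodory_comp _ (lebT R) R M D (fun t u => l t (x t) u) u mD).
  exact: u_meas.
exact: caratheodory_along.
Qed.

Lemma control_trajectory x u : S_f A U f t0 x0 (x, u) ->
  S_H A H t0 x0 x /\ (J_H H t0 x <= J_f l t0 (x, u))%E.
Proof.
move=> xu; have [/= x_ac u_meas aexu xt0 xA] := xu.
have Hl : {ae leb R, forall t : lebT R, D t ->
    (Hstar H t (x t) ('D_1 x t) <= (l t (x t) (u t))%:E)%E}.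
  apply: filterS aexu => t + Dt => /(_ Dt)[_ -> Uu].
  exact: (epi t (x t) (D_ge0 _ Dt)).2.
(* The running cost is real, so [Hstar] stays below [+oo], which is the domain condition of
   [S_H]. *)
have Sx : S_H A H t0 x0 x.
  split => //; apply: filterS2 aexu Hl => t + + Dt => /(_ Dt)[dx _ _] /(_ Dt) Hl.
  by split=> //; rewrite (le_lt_trans Hl)// ltry.
split; first exact: Sx.
apply: (ae_le_integral _ _ _ _ D _ _ mD _ _ Hl).
  exact: (trajectory_control x Sx).1.
exact: cost_measurable.
Qed.

Lemma trajectory_control_cost x : S_H A H t0 x0 x ->
  exists2 u, S_f A U f t0 x0 (x, u) & J_f l t0 (x, u) = J_H H t0 x.
Proof.
move=> Sx; have [mH [u xu Hl]] := trajectory_control x Sx.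
exists u; first exact: xu.
by apply/esym; apply: (ae_eq_integral _ _ mD mH _ Hl); exact: cost_measurable.
Qed.

Lemma trajectory_cost_well_defined x : S_H A H t0 x0 x ->
  integral_well_defined t0 (fun t => Hstar H t (x t) ('D_1 x t)).
Proof.
move=> Sx; apply: (integral_well_defined_ge _ _ _ phi t0_ge0 phi_L1).
  exact: (trajectory_control x Sx).1.
by move=> t; move/(le_trans t0_ge0); exact: Hstar_ge.
Qed.

Lemma control_cost_well_defined x u : S_f A U f t0 x0 (x, u) ->
  integral_well_defined t0 (fun t => (l t (x t) (u t))%:E).
Proof.
move=> xu; apply: (integral_well_defined_ge _ _ _ phi1 t0_ge0 phi1_L1).
  exact: cost_measurable.
by move=> t /(le_trans t0_ge0); rewrite lee_fin; exact: l_phi1.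
Qed.

(** Every pair has a trajectory that costs no more and every trajectory a pair of equal cost; empty
    sets are covered too. *)
Lemma value_functions_eq : V_H A H t0 x0 = V_f A U f l t0 x0.
Proof.
apply/eqP; rewrite eq_le; apply/andP; split; apply: le_ereal_inf_tmp.
  move=> _ [[x u] /control_trajectory[Sx Jle] <-].
  by apply: le_trans Jle; apply: ereal_inf_lbound; exists x.
move=> _ [x /trajectory_control_cost[u xu <-] <-].
by apply: ereal_inf_lbound; exists (x, u).
Qed.

End representation.

(** * Equality of the value functions and transfer of optimality *)

Theorem theorem4p6 (R : realType) (N M : nat)
  (A : set 'rV[R]_N) (U : R -> set 'rV[R]_M)
  (H : R -> 'rV[R]_N -> 'rV[R]_N -> R)
  (f : R -> 'rV[R]_N -> 'rV[R]_M -> 'rV[R]_N)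
  (l : R -> 'rV[R]_N -> 'rV[R]_M -> R)
  (phi phi1 : R -> R) :
  (* A nonempty closed *)
  A !=set0 -> closed A ->
  (* U measurable with nonempty closed images *)
  setval_measurable U ->
  (forall t, 0 <= t -> U t !=set0 /\ closed (U t)) ->
  (* H measurable in t, continuous in x, convex in p, H(t,x,0) <= -phi(t) *)
  (forall x p, measurable_fun (`[0, +oo[%classic : set (lebT R))
                  ((fun t => H t x p) : lebT R -> R)) ->
  (forall t p, 0 <= t -> continuous (fun x => H t x p)) ->
  convex_in_p H ->
  L1_pos phi ->
  (forall t x, 0 <= t -> H t x 0 <= - phi t) ->
  (* f, l Lebesgue measurable in t, continuous in (x,u), l >= phi1 *)
  (forall x u, vmeasurable (`[0, +oo[%classic : set (lebT R)) (fun t => f t x u)) ->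
  (forall x u, measurable_fun (`[0, +oo[%classic : set (lebT R))
                  ((fun t => l t x u) : lebT R -> R)) ->
  (forall t, 0 <= t -> continuous (fun xu : 'rV[R]_N * 'rV[R]_M => f t xu.1 xu.2)) ->
  (forall t, 0 <= t -> continuous (fun xu : 'rV[R]_N * 'rV[R]_M => l t xu.1 xu.2)) ->
  L1_pos phi1 ->
  (forall t x u, 0 <= t -> phi1 t <= l t x u) ->
  (* (U,f,l) epigraphical representation of H *)
  epi_representation H U f l ->
  (* V and \mathcal V are well defined *)
  (forall t0 x0, 0 <= t0 ->
     (forall x, S_H A H t0 x0 x ->
        integral_well_defined t0 (fun t => Hstar H t (x t) ('D_1 x t))) /\
     (forall xu, S_f A U f t0 x0 xu ->
        integral_well_defined t0 (fun t => (l t (xu.1 t) (xu.2 t))%:E))) /\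
  (* equality of the value functions *)
  (forall t0 x0, 0 <= t0 -> A x0 -> V_H A H t0 x0 = V_f A U f l t0 x0) /\
  (* optimal trajectory of V gives an optimal pair of \mathcal V *)
  (forall t0 x0 (xb : R -> 'rV[R]_N), 0 <= t0 -> A x0 ->
     (V_H A H t0 x0 < +oo)%E ->
     S_H A H t0 x0 xb -> J_H H t0 xb = V_H A H t0 x0 ->
     exists ub : R -> 'rV[R]_M,
       S_f A U f t0 x0 (xb, ub) /\ J_f l t0 (xb, ub) = V_f A U f l t0 x0) /\
  (* optimal pair of \mathcal V gives an optimal trajectory of V *)
  (forall t0 x0 (xb : R -> 'rV[R]_N) (ub : R -> 'rV[R]_M), 0 <= t0 -> A x0 ->
     (V_f A U f l t0 x0 < +oo)%E ->
     S_f A U f t0 x0 (xb, ub) -> J_f l t0 (xb, ub) = V_f A U f l t0 x0 ->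
     S_H A H t0 x0 xb /\ J_H H t0 xb = V_H A H t0 x0).
Proof.
move=> _ _ mU U_nc _ _ _ phiL Hphi mf ml cf cl phi1L lphi1 epi.
have clU t : 0 <= t -> closed (U t) by move=> /U_nc[].
have veq t0 x0 (t0_ge0 : 0 <= t0) : V_H A H t0 x0 = V_f A U f l t0 x0.
  exact: (value_functions_eq A U H f l mU clU mf ml cf cl epi).
split.
  move=> t0 x0 t0_ge0; split=> [x Sx|[x u] Sxu].
    exact: (trajectory_cost_well_defined A U H f l phi mU clU phiL Hphi mf ml
      cf cl epi t0 x0 t0_ge0 x Sx).
  exact: (control_cost_well_defined A U f l phi1 ml cl phi1L lphi1 t0 x0 t0_ge0
    x u Sxu).
split; first by move=> t0 x0 t0_ge0 _; exact: veq.
split=> [t0 x0 xb t0_ge0 _ _ Sx Jx|t0 x0 xb ub t0_ge0 _ _ Sxu Jxu].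
  have [ub Sxu Jxu] := trajectory_control_cost A U H f l mU clU mf ml cf cl epi
    t0 x0 t0_ge0 xb Sx.
  by exists ub; split; [exact: Sxu|rewrite Jxu Jx; exact: veq].
have [Sx Jle] := control_trajectory A U H f l mU clU mf ml cf cl epi
  t0 x0 t0_ge0 xb ub Sxu.
split; first exact: Sx.
(* Optimality gives [J_H H t0 xb <= J_f l t0 (xb, ub) = V_f A U f l t0 x0], which is
   [V_H A H t0 x0]; the infimum gives the reverse. *)
apply/eqP; rewrite eq_le; apply/andP; split.
  by rewrite veq// -Jxu.
by apply: ereal_inf_lbound; exists xb.
Qed.
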